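(* For every (discrete) groupoid $\mathcal{G}$ there exists a Furstenberg boundary $\partial_F\mathcal{G}$, that is, a $\mathcal{G}$-boundary having every $\mathcal{G}$-boundary as a $\mathcal{G}$-quotient; moreover such a maximal $\mathcal{G}$-boundary is unique (up to $\mathcal{G}$-isomorphism).
   Context: A groupoid $\mathcal{G}$ is regarded as discrete; $\mathcal{G}^{(0)}$ is its unit space, $r(g)=gg^{-1}$, $d(g)=g^{-1}g$, $gh$ is defined iff $d(g)=r(h)$, and $\mathcal{G}_u^v=\{g\in\mathcal{G}: d(g)=u,\ r(g)=v\}$. All topological spaces are nonempty, compact and Hausdorff. A $\mathcal{G}$-space is a bundle $\mathcal{X}=\{X_u\}_{u\in\mathcal{G}^{(0)}}$ of such spaces with homeomorphisms $\alpha_g:X_{d(g)}\to X_{r(g)}$ ($g\in\mathcal{G}$), written $\alpha_g(x)=g\cdot x$, such that $\alpha_u=\mathrm{id}_{X_u}$ for $u\in\mathcal{G}^{(0)}$ and $\alpha_g\circ\alpha_h=\alpha_{gh}$ whenever $gh$ is defined. A $\mathcal{G}$-subspace is a family of (nonempty, compact) subsets $Y_u\subseteq X_u$ such that each $\alpha_g$ restricts to a homeomorphism of $Y_{d(g)}$ onto $Y_{r(g)}$. A $\mathcal{G}$-map $\mathcal{X}\to\mathcal{Y}$ is a family of continuous maps $\phi_u:X_u\to Y_u$ ($u\in\mathcal{G}^{(0)}$) with $g\cdot\phi_{d(g)}(x)=\phi_{r(g)}(g\cdot x)$ for $g\in\mathcal{G}$, $x\in X_{d(g)}$; it is a $\mathcal{G}$-isomorphism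 if all $\phi_u$ are homeomorphisms. $\mathcal{Y}$ is a $\mathcal{G}$-quotient of $\mathcal{X}$ if there is a $\mathcal{G}$-map $\mathcal{X}\to\mathcal{Y}$ with all $\phi_u$ surjective. $P(X)$ is the set of Radon probability measures on $X$ with the weak$^*$-topology, with $X\subseteq P(X)$ as the point masses; for $g\in\mathcal{G}$, $\mu\in P(X_{d(g)})$, $(g\cdot\mu)(E)=\mu(g^{-1}\cdot E)$ for Borel $E\subseteq X_{r(g)}$. A $\mathcal{G}$-space $\mathcal{X}$ is minimal if it has no nontrivial $\mathcal{G}$-subspace (i.e. the only $\mathcal{G}$-subspace is $\mathcal{X}$ itself), and strongly proximal if for all $u,v\in\mathcal{G}^{(0)}$ with $\mathcal{G}_u^v\neq\emptyset$ and all $\mu\in P(X_u)$, the weak$^*$-closure $\overline{\mathcal{G}_u^v\cdot\mu}$ meets $X_v$. A $\mathcal{G}$-boundary is a minimal and strongly proximal (compact) $\mathcal{G}$-space. *)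

(* Defs.v *)
From HB Require Import structures.
From mathcomp Require Import all_boot all_order all_algebra.
From mathcomp Require Import all_classical all_reals all_analysis.

Set Implicit Arguments.
Unset Strict Implicit.
Unset Printing Implicit Defensive.

Import Order.TTheory GRing.Theory Num.Theory.
Import numFieldNormedType.Exports.

Local Open Scope classical_set_scope.
Local Open Scope ring_scope.

(* A groupoid is presented with its arrows sorted by domain and range:
   [arrow u v] is the set G_u^v of arrows with domain u and range v, and the
   unit at u is the arrow [gunit u]. The product [gmul g h] is gh, which is
   defined exactly when d(g) = r(h). *)
Record groupoid := Groupoid {
  gobj : Type;
  arrow : gobj -> gobj -> Type;
  gunit : forall u, arrow u u;
  gmul : forall u v w, arrow v w -> arrow u v -> arrow u w;
  ginv : forall u v, arrow u v -> arrow v u;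
  gmulA : forall u v w z (k : arrow w z) (g : arrow v w) (h : arrow u v),
    gmul k (gmul g h) = gmul (gmul k g) h;
  gmul1g : forall u v (g : arrow u v), gmul (gunit v) g = g;
  gmulg1 : forall u v (g : arrow u v), gmul g (gunit u) = g;
  gmulVg : forall u v (g : arrow u v), gmul (ginv g) g = gunit u;
  gmulgV : forall u v (g : arrow u v), gmul g (ginv g) = gunit v
}.

(* Nonempty compact Hausdorff spaces. Nonemptiness is given by the base point
   of a [ptopologicalType], which [measurableType] needs; maps are never
   required to preserve it. *)
Record compactSpace := CompactSpace {
  cspace :> ptopologicalType;
  cspace_compact : compact [set: cspace];
  cspace_hausdorff : hausdorff_space cspace
}.

Definition homeomorphism (X Y : topologicalType) (f : X -> Y) :=
  continuous f /\
  exists g : Y -> X, [/\ continuous g, cancel f g & cancel g f].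

(* f restricts to a homeomorphism of A onto B, for the subspace topologies. *)
Definition homeomorphism_on (X Y : topologicalType) (A : set X) (B : set Y)
    (f : X -> Y) :=
  [/\ {within A, continuous f}, f @` A `<=` B &
  exists g : Y -> X, [/\ {within B, continuous g}, g @` B `<=` A,
    forall x, A x -> g (f x) = x & forall y, B y -> f (g y) = y]].

Section RadonProbability.
Variable R : realType.

Definition borel (X : ptopologicalType) := g_sigma_algebraType (@open X).

(* Inner regularity by compact sets, on all Borel sets. *)
Definition is_radon (X : ptopologicalType) (mu : set X -> \bar R) :=
  forall A : set (borel X), measurable A ->
    mu A = ereal_sup [set mu K | K in [set K | compact K /\ K `<=` A]].

Record radonProb (X : compactSpace) := RadonProb {
  rprob :> probability (borel X) R;
  rprob_radon : is_radon rprob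
}.

HB.instance Definition _ (X : compactSpace) := gen_eqMixin (radonProb X).
HB.instance Definition _ (X : compactSpace) := gen_choiceMixin (radonProb X).

Definition rint (X : compactSpace) (mu : radonProb X) :
    {ptws continuousType X R -> R} :=
  fun f => \int[rprob mu]_x f x.

(* The weak* topology: the coarsest one making each mu |-> \int f dmu, for f
   real-valued continuous, continuous. As measures are functions on all
   subsets, two elements of [radonProb X] that agree on Borel sets need not be
   equal, but they are not separated by this topology. *)
HB.instance Definition _ (X : compactSpace) :=
  Topological.copy (radonProb X) (initial_topology (@rint X)).

Lemma compact_measurable (X : compactSpace) (K : set X) :
  compact K -> measurable (K : set (borel X)).
Proof.
move=> cK; rewrite -(setCK K); apply: measurableC.
apply: sub_sigma_algebra; apply: closed_openC.
by apply: compact_closed => //; exact: cspace_hausdorff.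
Qed.

Lemma is_radon_dirac (X : compactSpace) (x : X) :
  is_radon (dirac (x : borel X) : set _ -> \bar R).
Proof.
move=> A mA; apply/eqP; rewrite eq_le; apply/andP; split.
  have [xA|xA] := pselect (A x); last first.
    apply: ereal_sup_ubound; exists set0 => /=.
      by split; [exact: compact0 | exact: sub0set].
    by rewrite !diracE in_set0 memNset.
  apply: ereal_sup_ubound; exists [set (x : X)] => /=.
    by split; [exact: compact_set1 | move=> _ ->].
  by rewrite !diracE !mem_set.
apply: ge_ereal_sup => _ [K [cK KA] <-].
by apply: le_measure => //; rewrite inE//; exact: compact_measurable.
Qed.

Definition radon_dirac (X : compactSpace) (x : X) : radonProb X :=
  RadonProb (@is_radon_dirac X x).

Section Image.
Variables (X Y : compactSpace) (f : X -> Y) (cf : continuous f).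

Lemma continuous_borel : measurable_fun setT (f : borel X -> borel Y).
Proof.
apply: (@measurability _ _ (borel X) (borel Y) setT f (@open Y)) => //.
move=> _ [B oB <-]; rewrite setTI; apply: sub_sigma_algebra.
by move/continuousP : cf; exact.
Qed.

Definition borel_mfun : {mfun borel X >-> borel Y} :=
  HB.pack (f : borel X -> borel Y)
    (isMeasurableFun.Build _ _ (borel X) (borel Y) f continuous_borel).

Lemma is_radon_image (mu : radonProb X) :
  is_radon (distribution (rprob mu) borel_mfun).
Proof.
move=> A mA; apply/eqP; rewrite eq_le; apply/andP; split; last first.
  apply: ge_ereal_sup => _ [K [cK KA] <-].
  by apply: le_measure => //; rewrite inE//; exact: compact_measurable.
have mfA : measurable ((f @^-1` A) : set (borel X)).
  by rewrite -[X in measurable X]setTI; exact: continuous_borel.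
rewrite /distribution /pushforward /= (rprob_radon mu mfA).
apply: ge_ereal_sup => _ [K [cK KA] <-].
have cfK : compact (f @` K).
  by apply: continuous_compact => //; exact: continuous_subspaceT.
apply: (@le_trans _ _ (rprob mu (f @^-1` (f @` K)))).
  apply: le_measure; rewrite ?inE.
  - exact: compact_measurable.
  - rewrite -[X in measurable X]setTI; apply: continuous_borel => //.
    exact: compact_measurable.
  - by move=> x Kx; exists x.
apply: ereal_sup_ubound; exists (f @` K) => //=; split => //.
by move=> _ [x Kx <-]; exact: KA.
Qed.

(* The image measure E |-> mu (f @^-1` E). *)
Definition radon_image (mu : radonProb X) : radonProb Y :=
  RadonProb (is_radon_image mu).

End Image.
End RadonProbability.

Section GSpaces.
Variable G : groupoid.

Record Gspace := GSpace {
  fiber :> gobj G -> compactSpace;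
  act : forall u v, arrow u v -> fiber u -> fiber v;
  act_homeo : forall u v (g : arrow u v), homeomorphism (act g);
  act1 : forall u (x : fiber u), act (gunit u) x = x;
  actM : forall u v w (g : arrow v w) (h : arrow u v) (x : fiber u),
    act g (act h x) = act (gmul g h) x
}.

Lemma act_continuous (X : Gspace) u v (g : arrow u v) :
  continuous (@act X u v g).
Proof. by case: (act_homeo X g). Qed.

Definition Gsubspace (X : Gspace) (Y : forall u, set (X u)) :=
  (forall u, Y u !=set0 /\ compact (Y u)) /\
  (forall u v (g : arrow u v), homeomorphism_on (Y u) (Y v) (@act X u v g)).

Definition minimal (X : Gspace) :=
  forall Y : forall u, set (X u), Gsubspace Y -> forall u, Y u = [set: X u].

Definition Gmap (X Y : Gspace) (phi : forall u, X u -> Y u) :=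
  (forall u, continuous (phi u)) /\
  (forall u v (g : arrow u v) (x : X u),
     act g (phi u x) = phi v (act g x)).

Definition Gisomorphic (X Y : Gspace) :=
  exists2 phi : forall u, X u -> Y u, Gmap phi &
    forall u, homeomorphism (phi u).

Definition Gquotient_of (Y X : Gspace) :=
  exists2 phi : forall u, X u -> Y u, Gmap phi &
    forall u y, exists x, phi u x = y.

Variable R : realType.

(* (g . mu)(E) = mu (g^-1 . E), where g^-1 . E is the preimage of E under the
   homeomorphism x |-> g . x. *)
Definition act_prob (X : Gspace) u v (g : arrow u v) :
    radonProb R (X u) -> radonProb R (X v) :=
  radon_image (@act_continuous X u v g).

Definition strongly_proximal (X : Gspace) :=
  forall u v, [set: @arrow G u v] !=set0 -> forall mu : radonProb R (X u),
    closure [set act_prob g mu | g in [set: arrow u v]]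
      `&` range (@radon_dirac R (X v)) !=set0.

Definition Gboundary (X : Gspace) := minimal X /\ strongly_proximal X.

Definition Furstenberg_boundary (B : Gspace) :=
  Gboundary B /\ forall Y : Gspace, Gboundary Y -> Gquotient_of Y B.

End GSpaces.

(* Main.v *)
(* A compact Hausdorff G-space is strongly proximal as soon as maps into
   strongly proximal spaces separate its points: in a minimal closed
   invariant family of measures inside the orbit closure of a given one,
   "the image in Y is a point mass" is a closed invariant condition that
   holds somewhere, hence everywhere, and a measure all of whose images are
   point masses is itself a point mass. Instead of measures one can use
   contents on the closed sets. They form a compact space by Tychonoff's
   theorem, and every content m is dominated on closed sets by a Radon
   measure, which is enough to apply strong proximality. The Furstenberg
   boundary is a minimal closed invariant family in the closure of the
   arrows inside the cube whose coordinates are the functions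
   g |-> F (g y), with F continuous on a boundary Y and y a base point. Two
   equivariant maps from a minimal space to a strongly proximal one coincide,
   which gives uniqueness. *)
From HB Require Import structures.
Require Import Defs.
From mathcomp Require Import all_boot all_order all_algebra.
From mathcomp Require Import all_classical all_reals all_analysis.
From mathcomp Require Import measurable_realfun lra.

Set Implicit Arguments.
Unset Strict Implicit.
Unset Printing Implicit Defensive.

Import Order.TTheory GRing.Theory Num.Theory.
Import numFieldNormedType.Exports.

Local Open Scope classical_set_scope.
Local Open Scope ring_scope.

(** * Products and minimal subsystems *)

Lemma closed_preimage (X Y : topologicalType) (f : X -> Y) (C : set Y) :
  continuous f -> closed C -> closed (f @^-1` C).
Proof. by move=> /continuous_closedP; exact. Qed.

Lemma proj_cont (I : Type) (K : I -> topologicalType) (i : I) :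
  continuous (fun f : prod_topology K => f i).
Proof. exact: (@proj_continuous {classic I} K i). Qed.

Lemma cvg_to_prod (J I : Type) (K : I -> topologicalType)
    (F : set_system J) (h : J -> prod_topology K) (p : prod_topology K) :
  Filter F -> (forall i, h x i @[x --> F] --> p i) -> h @ F --> p.
Proof.
move=> FF ch; apply/cvg_sup => i A [_ [[B oB <-] Bx] BA].
by apply: filterS BA _; apply: ch; exact: open_nbhs_nbhs.
Qed.

Lemma continuous_to_prod (X : topologicalType) (I : Type)
    (K : I -> topologicalType) (h : X -> prod_topology K) :
  (forall i, continuous (fun x => h x i)) -> continuous h.
Proof. by move=> ch x; apply: cvg_to_prod => i; exact: ch. Qed.

Lemma hausdorff_prod (I : Type) (K : I -> topologicalType) :
  (forall i, hausdorff_space (K i)) -> hausdorff_space (prod_topology K).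
Proof. exact: (@hausdorff_product {classic I} K). Qed.

Lemma tychonoff_prod (I : Type) (K : I -> topologicalType)
    (A : forall i, set (K i)) : (forall i, compact (A i)) ->
  compact [set f : prod_topology K | forall i, A i (f i)].
Proof. exact: (@tychonoff {classic I} K). Qed.

(** * Minimal compact invariant families *)

Section MinimalSubsystem.
Variables (G : groupoid) (T : gobj G -> topologicalType).
Variable a : forall u v, arrow u v -> T u -> T v.
Variable P : set (gobj G).
Hypothesis hT : forall u, hausdorff_space (T u).

Definition invariant (S : forall u, set (T u)) :=
  forall u v (g : arrow u v), S u `<=` a g @^-1` S v.

(** Nonemptiness is asked only over [P]. The orbit closure of a point over [u] is empty over objects
    that no arrow from [u] reaches, so it is used with [P] equal to [[set u]]; the boundary itself
    needs [setT]. *)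
Definition subsystem (S : forall u, set (T u)) :=
  [/\ forall u, compact (S u), forall u, P u -> S u !=set0 & invariant S].

Definition minimal_subsystem (M : forall u, set (T u)) :=
  subsystem M /\
  forall S, subsystem S -> (forall u, S u `<=` M u) -> forall u, S u = M u.

(** Zorn's lemma for reverse inclusion among the subsystems inside [S0]. The empty chain is bounded
    by [S0], any other chain by its intersection. *)
Lemma exists_minimal_subsystem (S0 : forall u, set (T u)) : subsystem S0 ->
  exists2 M, minimal_subsystem M & forall u, M u `<=` S0 u.
Proof.
move=> sS0; pose U := {S | subsystem S /\ forall u, S u `<=` S0 u}.
pose rel (s t : U) := `[< forall u, sval t u `<=` sval s u >].
have s0 : U := exist _ S0 (conj sS0 (fun u => @subset_refl _ (S0 u))).
have [||A totA|[M [sM MS0]] Mmax] := @ZL_preorder U s0 rel.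
- by move=> s; apply/asboolP => u x.
- move=> r s t /asboolP rs /asboolP st; apply/asboolP => u.
  exact: subset_trans (st u) (rs u).
- have [[s1 As1]|A0] := pselect (A !=set0); last first.
    by exists s0 => s As; case: A0; exists s.
  pose I u := \bigcap_(s in A) sval s u.
  have clS (s : U) u : closed (sval s u).
    by apply: compact_closed => //; case: s => S [[]].
  have cI u : compact (I u).
    apply: (@subclosed_compact _ _ (sval s1 u)).
    - by apply: closed_bigI => s _; exact: clS.
    - by case: (s1) => S [[]].
    - exact: bigcap_inf.
  have sI : subsystem I.
    split => // [u Pu|u v g x Ix s As].
      (* The fibres of the chain over [u] form a filter base. A cluster point of it lies in each of
         them, as they are closed. *)
      have FF : ProperFilter (filter_from A (fun s : U => sval s u)).
        apply: filter_from_proper; last first.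
          by move=> s _; have [[_ + _] _] := svalP s; exact.
        apply: filter_from_filter; first by exists s1.
        move=> s t As At; have [/asboolP st|/asboolP ts] := totA _ _ As At.
          by exists t => // x tx; split=> //; exact: st.
        by exists s => // x tx; split=> //; exact: ts.
      have cs1 : compact (sval s1 u) by case: (s1) => S [[]].
      have [|p [_ clp]] := cs1 _ FF; first by exists s1.
      exists p => s As; apply: clS => V pV.
      by apply: clp => //; exists s.
    by have [[_ _]] := svalP s => + _; apply; exact: Ix.
  have IS0 : forall u, I u `<=` S0 u.
    by move=> u x /(_ s1 As1); have [_] := svalP s1; exact.
  exists (exist _ I (conj sI IS0)) => s As; apply/asboolP => u /=.
  exact: bigcap_inf.
- exists M => //; split => // S sS SM u; apply/seteqP; split; first exact: SM.
  have SS0 : forall u, S u `<=` S0 u by move=> w; exact: subset_trans (MS0 w).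
  have /(_ _)/asboolP := Mmax (exist _ S (conj sS SS0)).
  apply.
  by apply/asboolP => w; exact: SM.
Qed.

End MinimalSubsystem.

(** * Radon measures from contents *)

Section RadonOfContent.
Variables (R : realType) (X : topologicalType).

(* The values off the closed sets only matter through the bounds, which make
   the set of all such [m] compact for pointwise convergence. *)
Definition closed_content (m : set X -> R) :=
  [/\ forall E, 0 <= m E <= 1, m setT = 1,
      forall C D, closed C -> closed D -> C `<=` D -> m C <= m D,
      forall C D, closed C -> closed D -> m (C `|` D) <= m C + m D &
      forall C D, closed C -> closed D -> C `&` D = set0 ->
        m C + m D <= m (C `|` D)].

Lemma closed_content0 (m : set X -> R) : closed_content m -> m set0 = 0.
Proof.
case=> m01 _ _ _ madd; have /andP[m0 _] := m01 set0.
have := madd set0 set0 (@closed0 _) (@closed0 _) (set0I _).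
by rewrite setU0 => ?; apply/eqP; rewrite eq_le m0 andbT; lra.
Qed.

Local Open Scope ereal_scope.

(** With [outer_content], the classical passage from a content to a regular measure: open sets are
    measured from inside by closed sets, then all sets from outside by open sets. *)
Definition inner_content (m : set X -> R) (V : set X) : \bar R :=
  ereal_sup [set (m K)%:E | K in [set K | closed K /\ K `<=` V]].

Definition outer_content (m : set X -> R) (E : set X) : \bar R :=
  ereal_inf [set inner_content m V | V in [set V | open V /\ E `<=` V]].

Variables (m : set X -> R) (hm : closed_content m).
Let m01 : forall E, (0 <= m E <= 1)%R. Proof. by case: hm. Qed.
Let m1 : m setT = 1%R. Proof. by case: hm. Qed.
Let mS : forall C D, closed C -> closed D -> C `<=` D -> (m C <= m D)%R.
Proof. by case: hm. Qed.
Let mU : forall C D, closed C -> closed D -> (m (C `|` D) <= m C + m D)%R.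
Proof. by case: hm. Qed.
Let mDU : forall C D, closed C -> closed D -> C `&` D = set0 ->
  (m C + m D <= m (C `|` D))%R.
Proof. by case: hm. Qed.

Lemma le_inner_content K V : closed K -> K `<=` V ->
  (m K)%:E <= inner_content m V.
Proof. by move=> cK KV; apply: ereal_sup_ubound; exists K. Qed.

Lemma inner_content_ge0 V : 0 <= inner_content m V.
Proof.
have := @le_inner_content set0 V closed0 (@sub0set _ _).
by rewrite closed_content0.
Qed.

Lemma inner_content_le1 V : inner_content m V <= 1.
Proof.
apply: ge_ereal_sup => _ [K _ <-].
by rewrite lee_fin; case/andP: (m01 K).
Qed.

Lemma inner_contentS V W : V `<=` W -> inner_content m V <= inner_content m W.
Proof.
move=> VW; apply: ge_ereal_sup => _ [K [cK KV] <-].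
by apply: le_inner_content => //; exact: subset_trans VW.
Qed.

Lemma inner_content0 : inner_content m set0 = 0.
Proof.
apply/eqP; rewrite eq_le inner_content_ge0 andbT.
apply: ge_ereal_sup => _ [K [_ +] <-]; rewrite subset0 => ->.
by rewrite closed_content0.
Qed.

Lemma inner_contentT : inner_content m setT = 1.
Proof.
apply/eqP; rewrite eq_le inner_content_le1 /= -m1.
exact: le_inner_content closedT _.
Qed.

(** A closed set in the complement of [C] is disjoint from [C], and their union has content at most
    1. Passing to complements, this yields the domination in [radon_of_content]. *)
Lemma inner_contentC C : closed C -> inner_content m (~` C) <= 1 - (m C)%:E.
Proof.
move=> cC; apply: ge_ereal_sup => _ [K [cK KC] <-].
rewrite -EFinB lee_fin.
have KC0 : K `&` C = set0 by rewrite -subset0 => x [Kx Cx]; exact: KC Cx.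
have := mDU cK cC KC0; have /andP[_] := m01 (K `|` C); lra.
Qed.

Hypothesis cX : compact [set: X].
Hypothesis hX : hausdorff_space X.

Lemma content_le_sum_inner (V : (set X)^nat) n K : (forall i, open (V i)) ->
  closed K -> K `<=` \bigcup_(i < n) V i ->
  (m K)%:E <= \sum_(i < n) inner_content m (V i).
Proof.
move=> oV; elim: n K => [|n IH] K cK.
  rewrite bigcup_mkord big_ord0 subset0 => ->.
  by rewrite big_ord0 closed_content0.
rewrite bigcup_mkord big_ord_recr /= -bigcup_mkord => KV.
have cA : closed (K `\` V n) by apply: closedI => //; exact: open_closedC.
have oU : open (\bigcup_(i < n) V i) by exact: bigcup_open.
have AU : K `\` V n `<=` \bigcup_(i < n) V i by move=> x [/KV[]].
have nU : set_nbhs (K `\` V n) (\bigcup_(i < n) V i).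
  by apply/set_nbhsP; exists (\bigcup_(i < n) V i); split.
(* Normality splits [K] between two closed sets: [closure B], inside the first [n] open sets, and
   [K] minus [B'], inside [V n]. *)
have [B /set_nbhsP[B' [oB' AB' B'B]] BU] := compact_normal hX cX cA nU.
have cK2 : closed (K `\` B') by apply: closedI => //; exact: open_closedC.
have cB : closed (closure B) by exact: closed_closure.
rewrite big_ord_recr /=.
apply: (@le_trans _ _ ((m (closure B))%:E + (m (K `\` B'))%:E)).
  rewrite -EFinD lee_fin (le_trans _ (mU cB cK2))// mS//.
    exact: closedU.
  move=> x Kx; have [B'x|nB'x] := pselect (B' x); last by right.
  by left; apply: subset_closure; exact: B'B.
apply: leeD; first exact: IH.
apply: le_inner_content => // x [Kx nB'x]; apply: contrapT => nVx.
exact/nB'x/AB'.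
Qed.

Lemma closed_sub_bigcup (V : (set X)^nat) K : (forall i, open (V i)) ->
  closed K -> K `<=` \bigcup_i V i -> exists n, K `<=` \bigcup_(i < n) V i.
Proof.
move=> oV cK KV.
have /compact_near_coveringP kK : compact K by exact: subclosed_compact cX _.
have [] := kK nat \oo (fun n x => (\bigcup_(i < n) V i) x) _.
  move=> x /KV[i _ Vix]; exists (V i, [set n | (i < n)%N]) => /=.
    split; first by apply: open_nbhs_nbhs; split.
    by exists i.+1.
  by move=> [y n] /= [Viy ni]; exists i.
by move=> n _ /(_ n (leqnn n)) Kn; exists n.
Qed.

Lemma inner_content_sigma_subadditive (V : (set X)^nat) :
  (forall i, open (V i)) ->
  inner_content m (\bigcup_i V i) <= \sum_(i <oo) inner_content m (V i).
Proof.
move=> oV; apply: ge_ereal_sup => _ [K [cK KV] <-].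
have [n Kn] := closed_sub_bigcup oV cK KV.
rewrite (le_trans (content_le_sum_inner oV cK Kn))// 
  -(big_mkord xpredT (fun i => inner_content m (V i))).
by apply: nneseries_lim_ge => i _ _; exact: inner_content_ge0.
Qed.

Lemma outer_content_open V : open V -> outer_content m V = inner_content m V.
Proof.
move=> oV; apply/eqP; rewrite eq_le; apply/andP; split.
  by apply: ereal_inf_lbound; exists V => //; split.
by apply: le_ereal_inf_tmp => _ [W [oW VW] <-]; exact: inner_contentS.
Qed.

Lemma outer_content_ge0 E : 0 <= outer_content m E.
Proof.
by apply: le_ereal_inf_tmp => _ [W _ <-]; exact: inner_content_ge0.
Qed.

Lemma le_outer_content : {homo outer_content m : A B / A `<=` B >-> A <= B}.
Proof.
move=> A B AB; apply: ereal_inf_le_tmp => _ [W [oW BW] <-].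
by exists W => //; split => //; exact: subset_trans BW.
Qed.

Lemma outer_content_le1 E : outer_content m E <= 1.
Proof.
rewrite (le_trans (le_outer_content (@subsetT _ E)))//.
by rewrite outer_content_open ?inner_contentT//; exact: openT.
Qed.

Lemma outer_content0 : outer_content m set0 = 0.
Proof. by rewrite outer_content_open ?inner_content0//; exact: open0. Qed.

Lemma outer_content_fin E : outer_content m E \is a fin_num.
Proof.
rewrite ge0_fin_numE ?outer_content_ge0//.
by rewrite (le_lt_trans (outer_content_le1 _))// ltry.
Qed.

Lemma outer_content_sigma_subadditive : sigma_subadditive (outer_content m).
Proof.
move=> A; apply/lee_addgt0Pr => e e0.
rewrite (le_trans _ (epsilon_trick _ _ (ltW e0)))//; last first.
  by move=> n; exact: outer_content_ge0.
have /choice[V PV] (n : nat) : exists V, [/\ open V, A n `<=` V &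
    inner_content m V <= outer_content m (A n) + (e / (2 ^ n.+1)%:R)%:E].
  have en0 : (0 < e / (2 ^ n.+1)%:R)%R by rewrite divr_gt0.
  have [_ [V [oV AV] <-] lt] :=
    lb_ereal_inf_adherent en0 (outer_content_fin (A n)).
  by exists V; split => //; exact: ltW.
have oV i : open (V i) by case: (PV i).
apply: (@le_trans _ _ (inner_content m (\bigcup_i V i))).
  rewrite -outer_content_open; last exact: bigcup_open.
  by apply: le_outer_content; apply: subset_bigcup => i _; case: (PV i).
rewrite (le_trans (inner_content_sigma_subadditive oV))//.
apply: lee_nneseries => [i _ _|i _]; first exact: inner_content_ge0.
by case: (PV i).
Qed.

Definition outer_measure_of_content : {outer_measure set X -> \bar R} :=
  HB.pack (outer_content m) (isOuterMeasure.Build R X (outer_content m)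
    outer_content0 outer_content_ge0 le_outer_content
    outer_content_sigma_subadditive).

(** Open test sets [W] suffice. Take a closed [K] inside the intersection of [W] and [V], then a
    closed [L] inside the open set [W] minus [K], which contains [W] minus [V]. Since [K] and [L]
    are disjoint, [m K + m L] is at most the inner content of [W]. *)
Lemma open_caratheodory V : open V ->
  outer_measure_of_content.-caratheodory V.
Proof.
move=> oV; apply: le_caratheodory_measurable => A.
apply: le_ereal_inf_tmp => _ [W [oW AW] <-] /=.
apply: (@le_trans _ _ (inner_content m (W `&` V) + outer_content m (W `\` V))).
  apply: leeD; last by apply: le_outer_content; exact: setSD.
  rewrite -outer_content_open; last exact: openI.
  by apply: le_outer_content; exact: setSI.
rewrite -leeBrDr ?outer_content_fin//.
apply: ge_ereal_sup => _ [K [cK KWV] <-].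
rewrite leeBrDr ?outer_content_fin//.
apply: (@le_trans _ _ ((m K)%:E + inner_content m (W `\` K))).
  apply: leeD => //; rewrite -outer_content_open; last first.
    by apply: openI => //; exact: closed_openC.
  by apply: le_outer_content; apply: setDS => x /KWV[].
rewrite addeC -leeBrDr//; apply: ge_ereal_sup => _ [L [cL LWK] <-].
rewrite leeBrDr// -EFinD.
apply: (@le_trans _ _ (m (L `|` K))%:E).
  by rewrite lee_fin mDU// -subset0 => x [/LWK[]].
apply: le_inner_content; first exact: closedU.
by move=> x [/LWK[]|/KWV[]].
Qed.

End RadonOfContent.

(** * The Radon probability measure of a content *)

Section RadonMeasureOfContent.
Local Open Scope ereal_scope.
Variables (R : realType) (X : compactSpace) (m : set X -> R).
Hypothesis hm : closed_content m.

Let om : {outer_measure set X -> \bar R} :=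
  outer_measure_of_content hm (@cspace_compact X) (@cspace_hausdorff X).

Lemma borel_caratheodory (A : set (borel X)) :
  measurable A -> om.-caratheodory A.
Proof.
move: A; apply: smallest_sub => [|A oA]; last exact: open_caratheodory.
split.
- exact: caratheodory_measurable_set0.
- by move=> A cA; rewrite setTD; exact: caratheodory_measurable_setC.
- by move=> F cF; exact: caratheodory_measurable_bigcup.
Qed.

Let om_sigma_additive :
  semi_sigma_additive (outer_content m : set (borel X) -> \bar R).
Proof.
move=> F mF tF mUF.
apply: (@caratheodory_measure_sigma_additive R X om) => //.
- by move=> i; exact: borel_caratheodory (mF i).
- exact: borel_caratheodory mUF.
Qed.

Let om1 : outer_content m (setT : set (borel X)) = 1.
Proof.
by rewrite (outer_content_open m (@openT X)) inner_contentT.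
Qed.

Let muM : measure (borel X) R :=
  HB.pack (outer_content m : set (borel X) -> \bar R)
    (isMeasure.Build _ (borel X) R (outer_content m : set (borel X) -> \bar R)
      (outer_content0 hm) (outer_content_ge0 hm) om_sigma_additive).

Let muP : probability (borel X) R :=
  HB.pack (Measure.sort muM)
    (Measure_isProbability.Build _ (borel X) R (Measure.sort muM) om1).

(** Outer regularity by open sets is built into [outer_content]. Applied to the complement of [A],
    it gives inner regularity by closed sets, which are compact here. *)
Let muP_radon : is_radon muP.
Proof.
move=> A mA; apply/eqP; rewrite eq_le; apply/andP; split; last first.
  apply: ge_ereal_sup => _ [K [cK KA] <-].
  by apply: le_measure => //; rewrite inE//; exact: Defs.compact_measurable.
have mCA : measurable (~` A) by exact: measurableC.
apply/lee_addgt0Pr => e e0.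
have [_ [V [oV AV] <-] lt] :=
  lb_ereal_inf_adherent e0 (outer_content_fin hm (~` A)).
have mV : measurable (V : set (borel X)) by exact: sub_sigma_algebra.
apply: (@le_trans _ _ (muP (~` V) + e%:E)).
  have fV : muP V \is a fin_num by exact: fin_num_measure.
  have fA : muP (~` A) \is a fin_num by exact: fin_num_measure.
  have {}lt : muP V < muP (~` A) + e%:E.
    by rewrite (_ : muP V = inner_content m V)//; exact: outer_content_open.
  rewrite -[in leLHS](setCK A) (probability_setC muP mCA).
  rewrite (probability_setC muP mV); move: lt fV fA.
  case: (muP V) => [v| |] lt fV //; case: (muP (~` A)) lt => [a| |] lt fA //.
  move: lt.
  by rewrite -!EFinB -!EFinD lte_fin lee_fin; lra.
apply: leeD => //; apply: ereal_sup_ubound; exists (~` V) => //=; split.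
  apply: (subclosed_compact _ (@cspace_compact X)) => //.
  exact: open_closedC.
by move=> x nVx; apply: contrapT => /AV.
Qed.

Lemma radon_of_content :
  exists mu : radonProb R X, forall C, closed C -> (m C)%:E <= mu C.
Proof.
exists (RadonProb muP_radon) => C cC /=.
have oC : open (~` C) by exact: closed_openC.
have mC : measurable (~` C : set (borel X)) by exact: sub_sigma_algebra.
rewrite -(setCK C) [leRHS](probability_setC muP)// setCK.
rewrite leeBrDr ?fin_num_measure// addeC -leeBrDr//.
by rewrite (_ : muP _ = inner_content m (~` C)) ?inner_contentC//;
  exact: outer_content_open.
Qed.

End RadonMeasureOfContent.

(** * Strong proximality through contents *)

Section BorelIntegrals.
Variables (R : realType) (X : compactSpace) (P : probability (borel X) R).

Lemma continuous_borel_measurable (f : X -> R) : continuous f ->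
  measurable_fun setT (f : borel X -> R).
Proof.
move=> /continuousP cf.
apply: (measurability _ (RGenOpens.measurableE R)) => //.
move=> _ [_ [x [y ->]] <-]; rewrite setTI.
by apply: sub_sigma_algebra; apply: cf; exact: itv_open.
Qed.

Lemma continuous_compact_bounded (f : X -> R) : continuous f ->
  exists2 M, 0 <= M & forall x, `|f x| <= M.
Proof.
move=> cf; have : compact (f @` [set: X]).
  apply: continuous_compact; last exact: cspace_compact.
  exact: continuous_subspaceT.
move=> /compact_bounded[M [_ MM]]; exists (`|M| + 1) => [|x].
  by rewrite addr_ge0.
by apply: MM => //; rewrite ltr_pwDr// ler_norm.
Qed.

Lemma borel_integrable (f : X -> R) M :
  measurable_fun setT (f : borel X -> R) -> (forall x, `|f x| <= M) ->
  P.-integrable setT (EFin \o f).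
Proof.
move=> mf fM; apply: measurable_bounded_integrable => //.
  by apply: le_lt_trans (probability_le1 P measurableT) _; rewrite ltry.
exists M; split; first by rewrite num_real.
by move=> y My x _; exact: le_trans (fM x) (ltW My).
Qed.

Lemma Rintegral_indic (E : set (borel X)) : measurable E ->
  \int[P]_x (\1_E x : R) = fine (P E).
Proof. by move=> mE; rewrite /Rintegral integral_indic// setIT. Qed.

Lemma le_measure_Rintegral (f : X -> R) (E : set (borel X)) :
  continuous f -> (forall x, 0 <= f x) -> measurable E ->
  (forall x, E x -> 1 <= f x) -> fine (P E) <= \int[P]_x f x.
Proof.
move=> cf f0 mE Ef; have [M _ fM] := continuous_compact_bounded cf.
rewrite -Rintegral_indic//; apply: le_Rintegral => //.
- apply: (@borel_integrable _ 1) => //.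
  by move=> x; rewrite indicE normr_nat; case: (_ \in _).
- exact: borel_integrable (continuous_borel_measurable cf) fM.
- by move=> x _; rewrite indicE; case: (boolP (x \in E)) => [/set_mem/Ef|].
Qed.

(** The deviation of [f] from [c] is bounded pointwise by [d] plus [M] times the indicator of [E].
    In the application [c] is the value of [f] at a point and [E] is the complement of a
    neighbourhood of it, of small mass. *)
Lemma Rintegral_near_value (f : X -> R) (E : set (borel X)) c d M :
  continuous f -> measurable E -> 0 <= d -> 0 <= M ->
  (forall x, ~ E x -> `|f x - c| <= d) -> (forall x, `|f x - c| <= M) ->
  `|\int[P]_x f x - c| <= d + M * fine (P E).
Proof.
move=> cf mE d0 M0 fd fM; have [L L0 fL] := continuous_compact_bounded cf.
have mf := continuous_borel_measurable cf.
have cI (r : R) : P.-integrable setT (EFin \o cst r).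
  by apply: (@borel_integrable _ `|r|) => //; exact: measurable_cst.
have fI := borel_integrable mf fL.
have mfc : measurable_fun setT (fun x : borel X => f x - c).
  by apply: measurable_funB => //; exact: measurable_cst.
have EI : P.-integrable setT (EFin \o (\1_E : borel X -> R)).
  apply: (@borel_integrable _ 1) => //.
  by move=> x; rewrite indicE normr_nat; case: (_ \in _).
have MEI : P.-integrable setT (EFin \o (fun x => M * \1_E x)).
  apply: (@borel_integrable _ M); first exact: measurable_funM.
  move=> x; rewrite normrM indicE normr_nat ger0_norm// ler_piMr//.
  by case: (_ \in _).
have PT : fine (P setT) = 1 by rewrite probability_setT.
have -> : \int[P]_x f x - c = \int[P]_x (f x - c).
  by rewrite (RintegralB measurableT fI (cI c)) Rintegral_cst// PT mulr1.
apply: le_trans (le_normr_Rintegral _ _) _ => //.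
  exact: borel_integrable mfc fM.
have -> : d + M * fine (P E) = \int[P]_x (d + M * \1_E x).
  rewrite (RintegralD measurableT (cI d) MEI) Rintegral_cst// PT mulr1.
  by rewrite RintegralZl// Rintegral_indic.
apply: le_Rintegral => //.
- apply: (@borel_integrable _ M); first exact: measurableT_comp.
  by move=> x; rewrite normr_id.
- apply: (@borel_integrable _ (d + M)).
    by apply: measurable_funD => //; exact: measurable_funM.
  move=> x; rewrite (le_trans (ler_normD _ _))// ger0_norm// lerD2l.
  by rewrite normrM indicE normr_nat ger0_norm// ler_piMr//; case: (_ \in _).
- move=> x _; rewrite indicE; have [Ex|nEx] := boolP (x \in E).
    by rewrite mulr1 (le_trans (fM x))// lerDr.
  by rewrite mulr0 addr0; apply: fd => Ex; move: nEx; rewrite mem_set.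
Qed.

End BorelIntegrals.

Lemma closed_borel (X : compactSpace) (C : set X) :
  closed C -> measurable (C : set (borel X)).
Proof.
move=> cC; apply: Defs.compact_measurable.
exact: subclosed_compact (@cspace_compact X) _.
Qed.

Lemma compact_urysohn (R : realType) (X : compactSpace) (A B : set X) :
  closed A -> closed B -> A `&` B = set0 -> exists f : X -> R,
  [/\ continuous f, forall x, 0 <= f x <= 1, forall x, A x -> f x = 0 &
      forall x, B x -> f x = 1].
Proof.
move=> cA cB AB.
have nX := compact_normal (@cspace_hausdorff X) (@cspace_compact X).
have [f [cf fA fB f01]] := urysohn_ext_itv nX cA cB AB (@ltr01 R).
exists f; split => // [x|x Ax|x Bx].
- by have : `[0, 1]%classic (f x); [exact: f01|rewrite /= in_itv].
- by apply: fA; exists x.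
- by apply: fB; exists x.
Qed.

Lemma closed_act_preimage (G : groupoid) (X : Gspace G) u v (g : arrow u v)
    (C : set (X v)) : closed C -> closed (act g @^-1` C).
Proof. by apply: closed_preimage; exact: act_continuous. Qed.

Section StrongProximality.
Variables (R : realType) (G : groupoid).

(** A measure is controlled only on Borel sets, whereas [closed_content] bounds the value on every
    set; hence the default 0 off the closed sets. *)
Definition radon_content (X : compactSpace) (mu : radonProb R X) (E : set X) :
    R := if `[< closed E >] then fine (mu E) else 0.

Lemma radon_contentE (X : compactSpace) (mu : radonProb R X) (C : set X) :
  closed C -> radon_content mu C = fine (mu C).
Proof. by move=> cC; rewrite /radon_content asboolT. Qed.

Lemma closed_radon_content (X : compactSpace) (mu : radonProb R X) :
  closed_content (radon_content mu).
Proof.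
have finmu (C : set X) : closed C -> rprob mu C \is a fin_num.
  by move=> /closed_borel mC; exact: fin_num_measure.
split.
- move=> E; rewrite /radon_content; case: asboolP => cE; last first.
    by rewrite lexx ler01.
  rewrite fine_ge0//= -lee_fin fineK ?finmu//.
  by apply: probability_le1; exact: closed_borel.
- by rewrite radon_contentE ?probability_setT//; exact: closedT.
- move=> C D cC cD CD; rewrite !radon_contentE// fine_le ?finmu//.
  by apply: le_measure => //; rewrite inE; exact: closed_borel.
- move=> C D cC cD; have cCD : closed (C `|` D) by exact: closedU.
  rewrite !radon_contentE// -fineD ?finmu// fine_le ?fin_numD ?finmu//.
  by apply: measureU2; exact: closed_borel.
- move=> C D cC cD CD0; have cCD : closed (C `|` D) by exact: closedU.
  rewrite !radon_contentE// -fineD ?finmu// measureU//; exact: closed_borel.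
Qed.

(* The point mass at [x] is in the closure of the orbit of [m]; for contents
   this is expressed on complements of neighbourhoods of [x]. *)
Definition content_proximal (X : Gspace G) :=
  forall u v, [set: @arrow G u v] !=set0 ->
  forall m : set (X u) -> R, closed_content m ->
  exists x : X v, forall W, open W -> W x -> forall e, 0 < e ->
  exists g : arrow u v, m (act g @^-1` (~` W)) < e.

Lemma rint_continuous (X : compactSpace) (f : continuousType X R) :
  continuous (fun mu : radonProb R X => rint mu f).
Proof.
move=> mu; apply: (@continuous_comp _ _ _ (@rint R X) (fun h => h f)).
  exact: (@initial_continuous (radonProb R X) _ (@rint R X)).
exact: proj_cont.
Qed.

Lemma rint_dirac (X : compactSpace) (x : X) (f : continuousType X R) :
  rint (radon_dirac R x) f = f x.
Proof.
have mf : measurable_fun setT (EFin \o (f : borel X -> R)).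
  apply/measurable_EFinP; apply: (@continuous_borel_measurable R X f).
  exact: cts_fun.
rewrite /rint /Rintegral (integral_dirac (x : borel X) measurableT mf).
by rewrite diracT mul1e.
Qed.

(** Pass to a Radon measure that dominates [m] on closed sets. For a Urysohn function [f] with value
    0 at [x] and 1 off [W], a translate that is weak* close to the point mass at [x] has a small
    integral of [f], and this integral bounds its mass off [W]. *)
Lemma strongly_proximal_content (X : Gspace G) :
  strongly_proximal R X -> content_proximal X.
Proof.
move=> spX u v uv m hm; have [mu mmu] := radon_of_content hm.
have [nu [clx [x _ xnu]]] := spX u v uv mu; rewrite -{nu}xnu in clx.
exists x => W oW Wx e e0.
have cW : closed (~` W) by exact: open_closedC.
have cx : closed [set x].
  by apply: compact_closed; [exact: cspace_hausdorff|exact: compact_set1].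
have xW : [set x] `&` ~` W = set0.
  by rewrite -subset0 => y [/= yx]; apply; rewrite yx.
have [f [cf f01 fx fW]] := compact_urysohn R cx cW xW.
pose F : continuousType (X v) R := HB.pack f (isContinuous.Build _ _ f cf).
have : nbhs (radon_dirac R x) [set nu : radonProb R (X v) | rint nu F < e].
  apply: (@rint_continuous _ F (radon_dirac R x) [set r | r < e]).
  by rewrite rint_dirac [X in nbhs X _]fx//; exact: lt_nbhsl.
move=> /clx[_ [[g _ <-]]] /= Fe; exists g; apply: le_lt_trans Fe.
have cgW : closed (act g @^-1` (~` W)).
  exact: closed_act_preimage.
have := mmu _ cgW; rewrite -[leRHS]fineK; last first.
  by apply: fin_num_measure; exact: closed_borel.
rewrite lee_fin => /le_trans; apply.
apply: (@le_measure_Rintegral _ _ (rprob (act_prob g mu)) f (~` W)) => //.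
- by move=> y; have /andP[] := f01 y.
- exact: closed_borel.
- by move=> y /fW ->.
Qed.

(* The filter along which the translates of [m] converge to the point mass at
   [x]. *)
Definition concentrating (X : Gspace G) u v (m : set (X u) -> R) (x : X v) :
    set_system (arrow u v) :=
  filter_from [set We : set (X v) * R | [/\ open We.1, We.1 x & 0 < We.2]]
    (fun We => [set g : arrow u v | m (act g @^-1` (~` We.1)) < We.2]).

Lemma concentrating_filter (X : Gspace G) u v (m : set (X u) -> R) (x : X v) :
  closed_content m ->
  (forall W, open W -> W x -> forall e, 0 < e ->
    exists g : arrow u v, m (act g @^-1` (~` W)) < e) ->
  ProperFilter (concentrating m x).
Proof.
move=> hm hx; apply: filter_from_proper; last first.
  by move=> [W e] [/= oW Wx e0]; have [g] := hx W oW Wx e e0; exists g.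
apply: filter_from_filter.
  by exists (setT, 1); split => //=; exact: openT.
move=> [W e] [W' e'] [/= oW Wx e0] [/= oW' Wx' e0'].
exists (W `&` W', Num.min e e').
  by split => /=; [exact: openI|split|rewrite lt_min e0].
move=> g; rewrite /= lt_min => /andP[ge ge'].
(* Shrinking a neighbourhood enlarges its complement, so the bound for the intersection implies both
   given bounds. *)
have le A A' : open A -> open A' -> A `<=` A' ->
    m (act g @^-1` (~` A')) <= m (act g @^-1` (~` A)).
  move=> oA oA' AA'; have [_ _ + _ _] := hm; apply.
  - by apply: closed_act_preimage; exact: open_closedC.
  - by apply: closed_act_preimage; exact: open_closedC.
  - by apply: preimage_subset; exact: subsetC.
split; [apply: le_lt_trans ge|apply: le_lt_trans ge']; apply: le => //;
  by [exact: openI|move=> y []].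
Qed.

(** Along the [concentrating] filter the integral of any continuous [f] tends to [f x]: near [x] the
    function varies little, and the mass elsewhere tends to 0. *)
Lemma content_proximal_strongly (X : Gspace G) :
  content_proximal X -> strongly_proximal R X.
Proof.
move=> pX u v uv mu; have hm := closed_radon_content mu.
have [x hx] := pX u v uv _ hm; exists (radon_dirac R x).
split; last by exists x.
have FF := concentrating_filter hm hx.
pose F := concentrating (radon_content mu) x.
suff cv : (fun g : arrow u v => act_prob g mu) @ F --> radon_dirac R x.
  move=> N /cv [We DWe BN].
  have [g Bg] : [set g : arrow u v |
      radon_content mu (act g @^-1` (~` We.1)) < We.2] !=set0.
    by have [oW Wx e0] := DWe; have [g] := hx _ oW Wx _ e0; exists g.
  by exists (act_prob g mu); split; [exists g|exact: BN].
(* The weak* topology is initial for [rint], so convergence may be tested in the product, one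
   continuous function at a time. *)
suff cv : rint (act_prob g mu) @[g --> F] -->
    (rint (radon_dirac R x) : {ptws continuousType (X v) R -> R}).
  move=> N [_ [[U oU <-] Ux] UN].
  by apply: filterS UN _; apply: cv; exact: open_nbhs_nbhs.
apply: cvg_to_prod => f.
have cf : continuous f by exact: cts_fun.
rewrite rint_dirac.
have [M M0 fM] := continuous_compact_bounded cf.
apply/cvgrPdist_lt => e e0.
pose W := [set y | `|f x - f y| < e / 2].
have oW : open W.
  apply: (@open_comp _ _ f (ball (f x) (e / 2))) => [y _|]; first exact: cf.
  by apply: ball_open; rewrite divr_gt0.
(* [2 * M] bounds the oscillation of [f]; the added 1 makes [M'] positive, so that it can divide
   [e / 2]. *)
pose M' := 2 * M + 1; have M'0 : 0 < M' by rewrite ltr_wpDl// mulr_ge0.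
exists (W, e / 2 / M') => /=.
  split => //=; last by rewrite !divr_gt0.
  by rewrite /W /= subrr normr0 divr_gt0.
move=> g /=; rewrite radon_contentE => [ge|]; last first.
  by apply: closed_act_preimage; exact: open_closedC.
rewrite distrC.
apply: (@le_lt_trans _ _ (e / 2 + M' * fine (rprob (act_prob g mu) (~` W)))).
  apply: Rintegral_near_value => //.
  - by apply: closed_borel; exact: open_closedC.
  - by rewrite divr_ge0// ltW.
  - exact: ltW.
  - by move=> y /contrapT; rewrite /W /= distrC => /ltW.
  - move=> y; rewrite (le_trans (ler_normB _ _))// /M'.
    by rewrite mulr_natl mulr2n -addrA lerD// ler_wpDr.
by rewrite [ltRHS]splitr ltrD2l mulrC -ltr_pdivlMr.
Qed.

End StrongProximality.

(** * Lifting strong proximality *)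

Section ContentSpace.
Variable R : realType.

Lemma le_closure (T : topologicalType) (S : set T) (f h : T -> R) :
  continuous f -> continuous h -> (forall s, S s -> f s <= h s) ->
  forall p, closure S p -> f p <= h p.
Proof.
move=> cf ch fh p Sp; have cd : continuous (fun t => h t - f t).
  by move=> t; apply: cvgB; [exact: ch|exact: cf].
have cl : closed ((fun t => h t - f t) @^-1` [set r | 0 <= r]).
  exact: (closed_preimage cd (@closed_ge R 0)).
rewrite -subr_ge0; apply: (cl p).
by apply: closure_subset Sp => s Ss /=; rewrite subr_ge0 fh.
Qed.

Lemma continuous_add (T : topologicalType) (f h : T -> R) :
  continuous f -> continuous h -> continuous (fun t => f t + h t).
Proof. by move=> cf ch t; apply: cvgD; [exact: cf|exact: ch]. Qed.

Lemma continuous_mul (T : topologicalType) (f h : T -> R) :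
  continuous f -> continuous h -> continuous (fun t => f t * h t).
Proof. by move=> cf ch t; apply: cvgM; [exact: cf|exact: ch]. Qed.

Definition image_content (X Y : topologicalType) (f : X -> Y)
    (m : {ptws set X -> R}) : {ptws set Y -> R} := fun E => m (f @^-1` E).

Lemma image_content_continuous (X Y : topologicalType) (f : X -> Y) :
  continuous (image_content f).
Proof. by apply: continuous_to_prod => E; exact: proj_cont. Qed.

Lemma closed_image_content (X Y : topologicalType) (f : X -> Y)
    (m : set X -> R) : continuous f ->
  closed_content m -> closed_content (image_content f m).
Proof.
move=> /continuous_closedP cf [m01 m1 mS mU mDU]; split.
- by move=> E; exact: m01.
- exact: m1.
- by move=> C D cC cD CD; apply: mS; [exact: cf..|exact: preimage_subset].
- by move=> C D cC cD; apply: mU; exact: cf.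
- move=> C D cC cD CD; apply: mDU; [exact: cf..|].
  by rewrite -preimage_setI CD preimage_set0.
Qed.

Variable X : topologicalType.

(** Each condition is an equality or a weak inequality between continuous functions of the
    coordinates, so it passes to the closure. *)
Lemma closed_contents : closed [set m : {ptws set X -> R} | closed_content m].
Proof.
move=> p cp; have pc E : continuous (fun m : {ptws set X -> R} => m E).
  exact: proj_cont.
have pcD (C D : set X) : continuous (fun m : {ptws set X -> R} => m C + m D).
  exact: continuous_add.
have cc (r : R) : continuous (fun _ : {ptws set X -> R} => r).
  exact: cst_continuous.
split.
- move=> E; apply/andP; split.
    by apply: (le_closure (cc 0) (pc E)) cp => m [/(_ E)/andP[]].
  by apply: (le_closure (pc E) (cc 1)) cp => m [/(_ E)/andP[]].
- apply/eqP; rewrite eq_le; apply/andP; split.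
    by apply: (le_closure (pc setT) (cc 1)) cp => m [_ ->].
  by apply: (le_closure (cc 1) (pc setT)) cp => m [_ ->].
- move=> C D cC cD CD; apply: (le_closure (pc C) (pc D)) cp.
  by move=> m [_ _ + _ _]; apply.
- move=> C D cC cD; apply: (le_closure (pc _) (pcD C D)) cp.
  by move=> m [_ _ _ + _]; apply.
- move=> C D cC cD CD; apply: (le_closure (pcD C D) (pc _)) cp.
  by move=> m [_ _ _ _ +]; apply.
Qed.

Lemma compact_contents : compact [set m : {ptws set X -> R} | closed_content m].
Proof.
have := @tychonoff_prod (set X) (fun _ => R) (fun _ => `[0, 1]%classic).
move=> /(_ (fun _ => @segment_compact R 0 1)).
move=> cB; apply: (subclosed_compact closed_contents cB) => m [m01 _ _ _ _] E.
by rewrite /= in_itv /= m01.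
Qed.

End ContentSpace.

Section Lift.
Variables (R : realType) (G : groupoid) (X : Gspace G).

Let T (u : gobj G) : topologicalType := {ptws set (X u) -> R}.
Let a u v (g : arrow u v) : T u -> T v := image_content (act g).

Let hT u : hausdorff_space (T u).
Proof. by apply: hausdorff_prod => _; exact: Rhausdorff. Qed.

Definition orbit_closure u (m : set (X u) -> R) (w : gobj G) : set (T w) :=
  closure [set a g m | g in [set: arrow u w]].

Lemma orbit_closure_content u (m : set (X u) -> R) w n :
  closed_content m -> @orbit_closure u m w n -> closed_content n.
Proof.
move=> hm mn; apply: (@closed_contents R (X w)).
apply: closure_subset mn => _ [g _ <-].
by apply: closed_image_content hm; exact: act_continuous.
Qed.

Lemma orbit_closure_subsystem u (m : set (X u) -> R) : closed_content m ->
  subsystem a [set u] (orbit_closure m).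
Proof.
move=> hm; split.
- move=> w; apply: subclosed_compact (@compact_contents R (X w)) _.
    exact: closed_closure.
  by move=> n; exact: orbit_closure_content.
- move=> _ ->; exists (a (gunit u) m); apply: subset_closure.
  by exists (gunit u).
- move=> v w g n mn N /= /(@image_content_continuous R _ _ _ n) /mn.
  move=> [_ [[h _ <-] /=]] Nh; exists (a g (a h m)); split => //.
  exists (gmul g h) => //; apply/funext => E; rewrite /a /image_content.
  by congr (m _); apply/seteqP; split => x /=; rewrite actM.
Qed.

(* On a minimal subsystem this closed invariant condition holds throughout as
   soon as it holds once; it says that [n] is a point mass as seen from [Y]. *)
Lemma minimal_content_split u (m : set (X u) -> R) (M : forall w, set (T w))
    (Y : Gspace G) (phi : forall w, X w -> Y w) :
  closed_content m -> minimal_subsystem a [set u] M ->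
  (forall w, M w `<=` orbit_closure m (w:=w)) ->
  content_proximal R Y -> Gmap phi ->
  forall w n, M w n -> forall A B : set (Y w), closed A -> closed B ->
  A `&` B = set0 -> n (phi w @^-1` A) * n (phi w @^-1` B) = 0.
Proof.
move=> hm [[cM M0 iM] minM] MQ pY [cphi phiE].
pose D w := M w `&` [set n | forall A B : set (Y w), closed A -> closed B ->
  A `&` B = set0 -> n (phi w @^-1` A) * n (phi w @^-1` B) = 0].
have phi_act v w (g : arrow v w) (A : set (Y w)) :
    act g @^-1` (phi w @^-1` A) = phi v @^-1` (act g @^-1` A).
  by apply/seteqP; split => x /=; rewrite phiE.
have closedphi w (C : set (Y w)) : closed C -> closed (phi w @^-1` C).
  by apply: closed_preimage; exact: cphi.
suff sD : subsystem a [set u] D.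
  by move=> w n; rewrite -(minM D sD) => [|v x []//] [].
split.
- move=> w; apply: subclosed_compact (cM w) _; last by move=> n [].
  apply: closedI; first by apply: compact_closed (cM w); exact: hT.
  (* The condition is an intersection of zero sets of continuous functions, hence closed. *)
  have -> : [set n : T w | forall A B : set (Y w), closed A -> closed B ->
      A `&` B = set0 -> n (phi w @^-1` A) * n (phi w @^-1` B) = 0] =
      \bigcap_(AB in [set AB : set (Y w) * set (Y w) |
        [/\ closed AB.1, closed AB.2 & AB.1 `&` AB.2 = set0]])
      ((fun n : T w => n (phi w @^-1` AB.1) * n (phi w @^-1` AB.2)) @^-1`
        [set 0]).
    apply/seteqP; split => [n h [A B] /= []|n h A B cA cB AB]; first exact: h.
    exact: (h (A, B)).
  apply: closed_bigI => AB _.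
  have : continuous (fun n : T w =>
      n (phi w @^-1` AB.1) * n (phi w @^-1` AB.2)).
    by apply: continuous_mul; exact: proj_cont.
  move=> /closed_preimage; apply.
  by apply: compact_closed; [exact: Rhausdorff|exact: compact_set1].
- move=> _ ->; have [n0 Mn0] := M0 u erefl.
  have hn0 : closed_content n0 := orbit_closure_content hm (MQ _ _ Mn0).
  (* Strong proximality of [Y] moves the image of [n0] towards the point mass at some [y]. A cluster
     point of the moved [n0] stays in [M u], and its image gives no mass to closed sets avoiding
     [y]. *)
  have hp := closed_image_content (cphi u) hn0.
  have [|y hy] := pY u u _ _ hp; first by exists (gunit u).
  have FF := concentrating_filter hp hy.
  pose F := concentrating (image_content (phi u) n0) y.
  have PF : ProperFilter ((fun g => a g n0) @ F) by exact: fmap_proper_filter.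
  have FM : ((fun g : arrow u u => a g n0) @ F) (M u).
    by rewrite /fmap/=; apply: filterS (filterT) => g _; exact: iM.
  have [n [Mn cn]] := cM u _ PF FM; exists n.
  have hn : closed_content n := orbit_closure_content hm (MQ _ _ Mn).
  have nW W : open W -> W y -> n (phi u @^-1` (~` W)) = 0.
    move=> oW Wy; apply/eqP; rewrite eq_le andbC.
    have [/(_ (phi u @^-1` (~` W)))/andP[-> _] _ _ _ _ /=] := hn.
    apply/ler_addgt0Pr => e e0; rewrite add0r.
    pose S := [set p : T u | p (phi u @^-1` (~` W)) <= e].
    apply: (@le_closure R (T u) S (fun p => p (phi u @^-1` (~` W)))
      (fun _ => e)) => //.
    - exact: proj_cont.
    - exact: cst_continuous.
    - move=> N nN; apply: cn nN; exists (W, e); first by split.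
      by move=> g /= ge; rewrite /S /= /a /image_content phi_act; exact: ltW.
  (* Of two disjoint closed sets at least one avoids [y], so its factor vanishes. *)
  split=> // A B cA cB AB; have [Ay|nAy] := pselect (A y).
    have nBy : ~ B y by move=> By; rewrite -[False]/(set0 y) -AB.
    by rewrite -(setCK B) (nW (~` B)) ?mulr0//; exact: closed_openC.
  by rewrite -(setCK A) (nW (~` A)) ?mul0r//; exact: closed_openC.
- move=> v w g n [Mn hn]; split; first exact: iM.
  move=> A B cA cB AB; rewrite /a /image_content !phi_act; apply: hn.
  + exact: closed_act_preimage.
  + exact: closed_act_preimage.
  + by rewrite -preimage_setI AB preimage_set0.
Qed.

Hypothesis sepX : forall v (x x' : X v), x <> x' ->
  exists (Y : Gspace G) (phi : forall w, X w -> Y w),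
    [/\ content_proximal R Y, Gmap phi & phi v x <> phi v x'].

(** A member [n] of a minimal subsystem in the orbit closure of [m] has a one-point support: two
    support points would be separated by some [phi] into a [Y], against [minimal_content_split].
    Thus [n] sits at a point [b], and translates of [m] come close to [n]. *)
Lemma content_proximal_lift : content_proximal R X.
Proof.
move=> u v [g0 _] m hm.
have sQ := orbit_closure_subsystem hm.
have [M minM MQ] := exists_minimal_subsystem hT sQ.
have [[cM M0 iM] _] := minM; have [n0 Mn0] := M0 u erefl.
have [n Mn] : exists n, M v n by exists (a g0 n0); exact: iM.
have hn : closed_content n := orbit_closure_content hm (MQ _ _ Mn).
have n0E := closed_content0 hn.
have nge0 E : 0 <= n E by have [/(_ E)/andP[]] := hn.
(* The filter generated by the complements of closed null sets; its cluster points form the support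
   of [n]. *)
pose F : set_system (X v) :=
  filter_from [set C | closed C /\ n C = 0] (fun C => ~` C).
have PF : ProperFilter F.
  apply: filter_from_proper; last first.
    move=> C [cC nC0]; apply/set0P; apply/negP => /eqP C0.
    have CT : C = setT by rewrite -(setCK C) C0 setC0.
    have [_ n1 _ _ _] := hn; have := @oner_neq0 R.
    by rewrite -n1 -CT nC0 eqxx.
  apply: filter_from_filter; first by exists set0; split => //; exact: closed0.
  move=> C D [cC nC] [cD nD]; exists (C `|` D); last by rewrite setCU.
  split; first exact: closedU.
  apply/eqP; rewrite eq_le nge0 andbT; have [_ _ _ nU _] := hn.
  by apply: le_trans (nU _ _ cC cD) _; rewrite nC nD addr0.
have [b [_ Fb]] : [set: X v] `&` cluster F !=set0.
  by apply: (@cspace_compact (X v)) => //; exact: filterT.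
have Fb1 : cluster F = [set b].
  apply/seteqP; split => [b' Fb'|_ ->//].
  apply: contrapT => bb'; have [Y [phi [pY gphi phib]]] := sepX bb'.
  have [cphi _] := gphi.
  have split0 := minimal_content_split hm minM MQ pY gphi Mn.
  have c1 (y : Y v) : closed [set y].
    by apply: compact_closed; [exact: cspace_hausdorff|exact: compact_set1].
  have d0 : [set phi v b] `&` [set phi v b'] = set0.
    by rewrite -subset0 => y [/= -> /esym].
  have [f [cf _ fb fb']] := compact_urysohn R (c1 _) (c1 _) d0.
  have fb0 : f (phi v b) = 0 by exact: fb.
  have fb1 : f (phi v b') = 1 by exact: fb'.
  have cfp : continuous (f \o phi v).
    by move=> x; apply: continuous_comp; [exact: cphi|exact: cf].
  (* Disjoint closed neighbourhoods of the images of [b] and [b'], where [f] is 0 and 1. Neither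
     preimage is null, because [b] and [b'] are both in the support. *)
  pose A := f @^-1` [set r | r <= 1/3]; pose B := f @^-1` [set r | 2/3 <= r].
  have cA : closed A by exact: (closed_preimage cf (@closed_le R (1/3))).
  have cB : closed B by exact: (closed_preimage cf (@closed_ge R (2/3))).
  have AB : A `&` B = set0 by rewrite -subset0 => y [/=]; rewrite /A /B /=; lra.
  have key (x : X v) (C : set (Y v)) : closed C -> cluster F x ->
      nbhs x (phi v @^-1` C) -> n (phi v @^-1` C) != 0.
    move=> cC Fx xC; apply/eqP => nC0.
    have FC : F (~` (phi v @^-1` C)).
      exists (phi v @^-1` C) => //; split => //.
      by apply: closed_preimage cC; exact: cphi.
    by have [z [nCz Cz]] := Fx _ _ FC xC.
  have /eqP := split0 A B cA cB AB; apply/negP; rewrite mulf_neq0//.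
    apply: (key b) => //.
    have bA : nbhs b ((f \o phi v) @^-1` [set r | r < 1/3]).
      by apply: cfp; rewrite /= fb0; apply: lt_nbhsl; lra.
    by apply: filterS bA => x /=; rewrite /A /=; exact: ltW.
  apply: (key b') => //.
  have bB : nbhs b' ((f \o phi v) @^-1` [set r | 2/3 < r]).
    by apply: cfp; rewrite /= fb1; apply: lt_nbhsr; lra.
  by apply: filterS bB => x /=; rewrite /B /=; exact: ltW.
have Fcv : F --> b.
  apply: (@compact_cluster_set1 _ b F setT) => //.
  - exact: cspace_hausdorff.
  - exact: cspace_compact.
  - exact: filterT.
  - exact: filterT.
exists b => W oW Wb e e0.
(* Convergence of [F] to [b] says that the complement of [W] lies in a closed null set. *)
have [C [cC nC] CW] : F W by apply: Fcv; exact: open_nbhs_nbhs.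
have nW0 : n (~` W) <= 0.
  rewrite -nC; have [_ _ nS _ _] := hn; apply: nS => //.
    exact: open_closedC.
  by move=> x nWx; apply: contrapT => /CW.
have : nbhs n [set p : T v | p (~` W) < e].
  apply: (@proj_cont _ _ (~` W) n [set r | r < e]).
  by apply: lt_nbhsl; exact: le_lt_trans e0.
by move=> /(MQ _ _ Mn)[_ [[g _ <-] /= ge]]; exists g.
Qed.

End Lift.

(** * Subsystems as G-spaces *)

Section Subspace.
Variables (T : topologicalType) (K : set T).

Lemma set_val_continuous : continuous (set_val : set_type K -> T).
Proof. exact: (@initial_continuous (set_type K) T set_val). Qed.

Lemma compact_set_type : compact K -> compact [set: set_type K].
Proof.
move=> cK F PF _; have PvF : ProperFilter (set_val @ F).
  exact: fmap_proper_filter.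
have [|p [Kp clp]] := cK (set_val @ F) PvF.
  have : F (set_val @^-1` K) by apply: filterS filterT => x _; exact: set_valP.
  exact.
exists (SigSub (mem_set Kp)); split => // A B FA [_ [[U oU <-] /= Up] UB].
have nU := open_nbhs_nbhs (conj oU Up).
have [|_ [[x Ax <-] Ux]] := clp (set_val @` A) U _ nU.
  have : F (set_val @^-1` (set_val @` A)); last exact.
  by apply: filterS FA => x Ax; exists x.
by exists x; split => //; exact: UB.
Qed.

Lemma hausdorff_set_type : hausdorff_space T -> hausdorff_space (set_type K).
Proof.
move=> hT p q pq; apply: val_inj; apply: hT => A B pA qB.
have [x [Ax Bx]] := pq _ _ (set_val_continuous pA) (set_val_continuous qB).
by exists (set_val x).
Qed.

Hypotheses (hT : hausdorff_space T) (cK : compact K) (K0 : K !=set0).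

Definition set_ptopology : ptopologicalType :=
  HB.pack (set_type K)
    (isPointed.Build (set_type K) (SigSub (mem_set (svalP (cid K0))))).

Definition set_compactSpace : compactSpace :=
  @CompactSpace set_ptopology (compact_set_type cK) (hausdorff_set_type hT).

End Subspace.

(** Inclusion suffices, since the inverse arrow also preserves the family and provides the inverse
    map. *)
Lemma Gsubspace_compact_invariant (G : groupoid) (X : Gspace G)
    (S : forall u, set (X u)) : (forall u, compact (S u)) ->
  (forall u, S u !=set0) -> invariant (@act G X) S -> Gsubspace S.
Proof.
move=> cS S0 iS; split => // u v g; split.
- by apply: continuous_subspaceT; exact: act_continuous.
- by move=> _ [x Sx <-]; exact: iS.
- exists (act (ginv g)); split.
  + by apply: continuous_subspaceT; exact: act_continuous.
  + by move=> _ [x Sx <-]; exact: iS.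
  + by move=> x _; rewrite actM gmulVg act1.
  + by move=> x _; rewrite actM gmulgV act1.
Qed.

Lemma minimal_image_surjective (G : groupoid) (X Y : Gspace G)
    (phi : forall u, X u -> Y u) :
  minimal Y -> Gmap phi -> forall u y, exists x, phi u x = y.
Proof.
move=> minY [cphi phiE] u y.
have : [set: Y u] y by [].
rewrite -(minY (fun u => range (phi u))) => [[x _ <-]|]; first by exists x.
apply: Gsubspace_compact_invariant => [v|v|v w g _ [x _ <-]].
- apply: continuous_compact; last exact: cspace_compact.
  by apply: continuous_subspaceT; exact: cphi.
- by exists (phi v point), point.
- by exists (act g x); rewrite ?phiE.
Qed.

Section SubsystemGspace.
Variables (G : groupoid) (T : gobj G -> topologicalType).
Variable a : forall u v, arrow u v -> T u -> T v.
Hypothesis hT : forall u, hausdorff_space (T u).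
Hypothesis ca : forall u v (g : arrow u v), continuous (a g).
Hypothesis a1 : forall u (x : T u), a (gunit u) x = x.
Hypothesis aM : forall u v w (g : arrow v w) (h : arrow u v) (x : T u),
  a g (a h x) = a (gmul g h) x.
Variable M : forall u, set (T u).
Hypothesis sM : subsystem a setT M.

Let cM u : compact (@M u). Proof. by case: sM. Qed.
Let M0 u : @M u !=set0. Proof. by case: sM => _ + _; apply. Qed.
Let iM : invariant a M. Proof. by case: sM. Qed.

Let fib u := set_compactSpace (@hT u) (@cM u) (M0 u).

Let act_sub u v (g : arrow u v) (x : fib u) : fib v :=
  SigSub (mem_set (iM g (set_valP x) : @M v (a g (set_val x)))).

Let act_sub_continuous u v (g : arrow u v) : continuous (act_sub g).
Proof.
apply: (@continuous_comp_initial (set_type (@M v)) (fib u) (T v) set_val).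
move=> x; apply: (@continuous_comp (fib u) _ _ set_val (a g)); last exact: ca.
exact: set_val_continuous.
Qed.

Let act_sub1 u (x : fib u) : act_sub (gunit u) x = x.
Proof. by apply: val_inj; exact: a1. Qed.

Let act_subM u v w (g : arrow v w) (h : arrow u v) (x : fib u) :
  act_sub g (act_sub h x) = act_sub (gmul g h) x.
Proof. by apply: val_inj; exact: aM. Qed.

Let act_sub_homeo u v (g : arrow u v) : homeomorphism (act_sub g).
Proof.
split; first exact: act_sub_continuous.
exists (act_sub (ginv g)); split; first exact: act_sub_continuous.
- by move=> x; rewrite act_subM gmulVg act_sub1.
- by move=> x; rewrite act_subM gmulgV act_sub1.
Qed.

Definition subsystem_Gspace : Gspace G :=
  GSpace act_sub_homeo act_sub1 act_subM.

(** The inclusion maps a G-subspace onto a subsystem of the ambient family inside [M], to which the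
    minimality of [M] applies. *)
Lemma subsystem_Gspace_minimal :
  (forall S, subsystem a setT S -> (forall u, S u `<=` @M u) ->
    forall u, S u = @M u) -> minimal subsystem_Gspace.
Proof.
move=> minM Y [Y0 hY] u; apply/seteqP; split => // x _.
pose S u : set (T u) := [set set_val y | y in (Y u : set (fib u))].
have SM v : S v `<=` @M v by move=> _ [y _ <-]; exact: set_valP.
have sS : subsystem a setT S.
  split.
  - move=> v; apply: continuous_compact; last by case: (Y0 v).
    apply: continuous_subspaceT; exact: set_val_continuous.
  - by move=> v _; have [[y Yy] _] := Y0 v; exists (set_val y), y.
  - move=> v w g _ [y Yy <-]; exists (act_sub g y) => //.
    by have [_ + _] := hY v w g; apply; exists y.
have : S u (set_val x) by rewrite (minM S sS SM u); exact: set_valP.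
by move=> [y Yy /val_inj <-].
Qed.

End SubsystemGspace.

(** * Uniqueness and existence *)

Section Uniqueness.
Variables (R : realType) (G : groupoid).

(** The average of two point masses: if its translates concentrate at one point, both points are
    carried there. *)
Lemma closed_content_half_sum (X : topologicalType) (x y : X) :
  closed_content (fun E : set X => ((x \in E)%:R + (y \in E)%:R) / 2 : R).
Proof.
have i01 (b : bool) : 0 <= (b%:R : R) <= 1 by case: b; rewrite ?lexx ?ler01.
have iS (z : X) (C D : set X) : C `<=` D -> (z \in C)%:R <= (z \in D)%:R :> R.
  move=> CD; have [/set_mem/CD/mem_set ->//|_] := boolP (z \in C).
  exact: ler0n.
have iU (z : X) (C D : set X) :
    (z \in C `|` D)%:R <= (z \in C)%:R + (z \in D)%:R :> R.
  by rewrite in_setU; case: (z \in C); case: (z \in D) => /=; lra.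
have iDU (z : X) (C D : set X) : C `&` D = set0 ->
    (z \in C)%:R + (z \in D)%:R <= (z \in C `|` D)%:R :> R.
  move=> CD; have : z \notin C `&` D by rewrite CD in_set0.
  by rewrite in_setI in_setU; case: (z \in C); case: (z \in D) => //= _; lra.
split.
- by move=> E; have := i01 (x \in E); have := i01 (y \in E); lra.
- by rewrite !in_setT -mulr2n divff ?pnatr_eq0.
- by move=> C D _ _ CD; have := iS x _ _ CD; have := iS y _ _ CD; lra.
- by move=> C D _ _; have := iU x C D; have := iU y C D; lra.
- by move=> C D _ _ CD; have := iDU x _ _ CD; have := iDU y _ _ CD; lra.
Qed.

(** The coincidence set is closed and invariant, so by minimality it only has to be nonempty over
    each object. Concentrate the average of the point masses at the two images of the base point; a
    cluster point of the moved base point then has the same image under both maps. *)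
Lemma Gmap_unique (B X : Gspace G) (phi psi : forall u, B u -> X u) :
  minimal B -> content_proximal R X -> Gmap phi -> Gmap psi ->
  forall u b, phi u b = psi u b.
Proof.
move=> minB pX [cphi phiE] [cpsi psiE] u b.
pose S u := [set b | phi u b = psi u b].
suff sS : Gsubspace S by have : [set: B u] b by []; rewrite -(minB S sS u).
apply: Gsubspace_compact_invariant => [v|v|v w g c Sc]; last first.
- by rewrite /S /= -phiE -psiE Sc.
- pose m := fun E : set (X v) =>
    ((phi v point \in E)%:R + (psi v point \in E)%:R) / 2 : R.
  have hm : closed_content m by exact: closed_content_half_sum.
  have [|x hx] := pX v v _ _ hm; first by exists (gunit v).
  have FF := concentrating_filter hm hx.
  pose F := concentrating m x.
  have PF : ProperFilter ((fun g => act g (point : B v)) @ F).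
    exact: fmap_proper_filter.
  have [|c [_ Fc]] := @cspace_compact (B v) _ PF; first exact: filterT.
  have key (chi : forall w, B w -> X w) : Gmap chi ->
      (chi v point = phi v point \/ chi v point = psi v point) ->
      chi v c = x.
    move=> [cchi chiE] chi_or; apply/esym/(@cspace_hausdorff (X v)).
    move=> A C; rewrite nbhsE => -[W [oW Wx] WA] cC.
    (* Each of the two points weighs 1/2, so mass below 1/2 off [W] forces both of them into [W]. *)
    pose D := [set g : arrow v v | m (act g @^-1` (~` W)) < 1 / 2].
    have FD : (act g (point : B v) @[g --> F])
        [set act g (point : B v) | g in D].
      exists (W, 1 / 2) => /=; first by split => //=; lra.
      by move=> g gW /=; exists g.
    have [_ [[g gW <-] Cg]] := Fc _ _ FD (cchi v _ _ cC).
    exists (chi v (act g point)); split; last exact: Cg.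
    apply: WA; rewrite -chiE; apply: contrapT => nW; move: gW; rewrite /D /m /=.
    have nWE z : ~ W (act g z) -> z \in act g @^-1` (~` W).
      by move=> ?; rewrite inE.
    case: chi_or nW => -> /nWE ->.
      by case: (_ \in _) => /=; lra.
    by case: (_ \in _) => /=; lra.
  by exists c; rewrite /S /= (key phi) ?(key psi)//; [right|left].
- apply: subclosed_compact (@cspace_compact (B v)) _ => //.
  move=> c Sc; apply: (@cspace_hausdorff (X v)) => A C nA nC.
  have n1 : nbhs c (phi v @^-1` A) by exact: cphi.
  have n2 : nbhs c (psi v @^-1` C) by exact: cpsi.
  have [d [Sd [Ad Cd]]] := Sc _ (filterI n1 n2).
  by exists (phi v d); split => //; rewrite Sd.
Qed.

(** Maximality gives maps both ways, and by [Gmap_unique] both composites are identities. *)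
Lemma Furstenberg_boundary_unique (B B' : Gspace G) :
  Furstenberg_boundary R B -> Furstenberg_boundary R B' -> Gisomorphic B B'.
Proof.
move=> [[mB pB] uB] [[mB' pB'] uB'].
have [phi [cphi phiE] _] := uB B' (conj mB' pB').
have [psi [cpsi psiE] _] := uB' B (conj mB pB).
have id_Gmap (X : Gspace G) : Gmap (fun u (x : X u) => x).
  by split => // u x; exact: cvg_id.
exists phi => // u; split; first exact: cphi.
exists (psi u); split; first exact: cpsi.
- move=> x; apply: (@Gmap_unique B B (fun u x => psi u (phi u x))) => //.
    exact: strongly_proximal_content.
  split => [v y|v w g y]; last by rewrite -phiE -psiE.
  by apply: continuous_comp; [exact: cphi|exact: cpsi].
- move=> x; apply: (@Gmap_unique B' B' (fun u x => phi u (psi u x))) => //.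
    exact: strongly_proximal_content.
  split => [v y|v w g y]; last by rewrite phiE psiE.
  by apply: continuous_comp; [exact: cpsi|exact: cphi].
Qed.

End Uniqueness.

(** * Construction of the boundary inside a cube *)

Section Existence.
Variables (R : realType) (G : groupoid).

Let A (v : gobj G) : Type := {u : gobj G & arrow u v}.
(** The coordinates are indexed by all functions on the arrows into [v], rather than by boundaries
    with functions on them, so the index type depends only on [G] and [R]. *)
Let W (v : gobj G) : topologicalType := {ptws (A v -> R) -> R}.

Let translate v w (k : arrow v w) (p : A v) : A w :=
  existT _ (projT1 p) (gmul k (projT2 p)).

Let a v w (k : arrow v w) : W v -> W w := fun b f => b (f \o translate k).

Let a_continuous v w (k : arrow v w) : continuous (a k).
Proof. by apply: continuous_to_prod => f; exact: proj_cont. Qed.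

Let a1 v (b : W v) : a (gunit v) b = b.
Proof.
apply/funext => f; congr (b _); apply/funext => -[u g] /=.
by rewrite /translate /= gmul1g.
Qed.

Let aM u v w (g : arrow v w) (h : arrow u v) (b : W u) :
  a g (a h b) = a (gmul g h) b.
Proof.
apply/funext => f; congr (b _); apply/funext => -[z k] /=.
by rewrite /translate /= gmulA.
Qed.

Let hW v : hausdorff_space (W v).
Proof. by apply: hausdorff_prod => _; exact: Rhausdorff. Qed.

Let orb (Y : Gspace G) v (p : A v) : Y v := act (projT2 p) point.

Let unit_valued (T : topologicalType) (F : T -> R) :=
  continuous F /\ forall y, 0 <= F y <= 1.

(* The functions on the arrows into [v] that are restrictions to an orbit of
   continuous functions on a boundary. Quantifying over all boundaries here, in
   [Prop], is what lets the boundary below live on a type bounded by [G]. *)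
Let boundary_function v (f : A v -> R) :=
  exists Y : Gspace G, Gboundary R Y /\
  exists2 F : Y v -> R, unit_valued F & f = F \o @orb Y v.

(** The default 0 keeps all coordinates in the unit interval and, through [hull_non_boundary], makes
    distinct points of the hull differ at a boundary function. *)
Let ev v (p : A v) : W v := fun f =>
  if `[< boundary_function f >] then f p else 0.

Let orb_translate (Y : Gspace G) v w (k : arrow v w) p :
  @orb Y w (translate k p) = act k (orb Y p).
Proof. by rewrite /orb actM. Qed.

Let boundary_function_translate v w (k : arrow v w) f :
  boundary_function f -> boundary_function (f \o translate k).
Proof.
move=> [Y [bY [F [cF F01] ->]]]; exists Y; split => //.
exists (F \o act k); last by apply/funext => p /=; rewrite orb_translate.
split => [y|y]; last exact: F01.
by apply: continuous_comp; [exact: act_continuous|exact: cF].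
Qed.

Let a_ev v w (k : arrow v w) p : a k (ev p) = ev (translate k p).
Proof.
apply/funext => f; rewrite /a /ev; case: asboolP => kf; case: asboolP => bf //.
  (* Translating back by the inverse arrow shows that [f] itself is a boundary function. *)
  case: bf; have := boundary_function_translate (ginv k) kf.
  congr boundary_function; apply/funext => -[u g] /=.
  by rewrite /translate /= gmulA gmulgV gmul1g.
by case: kf; exact: boundary_function_translate.
Qed.

Let hull v : set (W v) := closure (range (@ev v)).

Let ev01 v (p : A v) f : 0 <= ev p f <= 1.
Proof.
rewrite /ev; case: asboolP => [[Y [_ [F [_ F01] ->]]]|_]; first exact: F01.
by rewrite lexx ler01.
Qed.

Let hull_compact v : compact (@hull v).
Proof.
have := @tychonoff_prod (A v -> R) (fun _ => R) (fun _ => `[0, 1]%classic).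
move=> /(_ (fun _ => @segment_compact R 0 1)) c01.
apply: (subclosed_compact _ c01); first exact: closed_closure.
move=> b hb f; rewrite /= in_itv /=.
have cf : continuous (fun b : W v => b f) by exact: proj_cont.
apply/andP; split.
  apply: (le_closure (@cst_continuous (W v) R 0) cf) hb => _ [p _ <-].
  by case/andP: (ev01 p f).
apply: (le_closure cf (@cst_continuous (W v) R 1)) hb => _ [p _ <-].
by case/andP: (ev01 p f).
Qed.

Let hull_subsystem : subsystem a setT hull.
Proof.
split; first exact: hull_compact.
- move=> v _; pose p : A v := existT (fun u => arrow u v) v (gunit v).
  by exists (ev p); apply: subset_closure; exists p.
- move=> v w k b hb N /= /(@a_continuous _ _ k b) /hb [_ [[p _ <-] /=]] Nb.
  by exists (a k (ev p)); split => //; rewrite a_ev; exists (translate k p).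
Qed.

Let hull_non_boundary v b f : @hull v b -> ~ boundary_function f -> b f = 0.
Proof.
move=> hb nf; have cf : continuous (fun b : W v => b f) by exact: proj_cont.
have ev0 p : ev p f = 0 by rewrite /ev asboolF.
apply/eqP; rewrite eq_le; apply/andP; split.
  apply: (le_closure cf (@cst_continuous (W v) R 0)) hb => _ [p _ <-].
  by rewrite ev0.
apply: (le_closure (@cst_continuous (W v) R 0) cf) hb => _ [p _ <-].
by rewrite ev0.
Qed.

(** * The equivariant map from the hull to a given boundary *)

Section MapToBoundary.
Variables (Y : Gspace G) (bY : Gboundary R Y).

Let represents v (b : W v) (y : Y v) :=
  forall F : Y v -> R, unit_valued F -> F y = b (F \o @orb Y v).

(** The point [b] is a limit of arrows. The points to which these carry the base points cluster at
    some [y] by compactness, and continuity of [F] identifies [F y] with the coordinate of [b]. *)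
Let represents_ex v b : @hull v b -> exists y, represents b y.
Proof.
move=> hb.
pose N := filter_from (nbhs b) (fun U => @ev v @^-1` U).
have NF : ProperFilter N.
  apply: filter_from_proper; last first.
    by move=> U /hb [_ [[p _ <-] Up]]; exists p.
  apply: filter_from_filter; first by exists setT; exact: filterT.
  by move=> U V bU bV; exists (U `&` V) => //; exact: filterI.
have PF : ProperFilter (@orb Y v @ N) by exact: fmap_proper_filter.
have [|y [_ Ny]] := @cspace_compact (Y v) _ PF; first exact: filterT.
exists y => F [cF F01]; set f := F \o @orb Y v.
have bf : boundary_function f by exists Y; split => //; exists F.
(* With half the distance as [e], an arrow whose value is within [e] of both numbers is a
   contradiction. *)
apply: contrapT => /eqP nE; pose e := `|F y - b f| / 2.
have e0 : 0 < e by rewrite divr_gt0// normr_gt0 subr_eq0.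
have nbf : nbhs b [set b' : W v | `|b f - b' f| < e].
  have cf : continuous (fun b : W v => b f) by exact: proj_cont.
  by apply: (cf b (ball (b f) e)); exact: nbhsx_ballx.
have nyF : nbhs y [set y' | `|F y - F y'| < e].
  by apply: (cF y (ball (F y) e)); exact: nbhsx_ballx.
have [|_ [[p pb <-] pF]] := Ny
    (@orb Y v @` (@ev v @^-1` [set b' : W v | `|b f - b' f| < e])) _ _ nyF.
  by exists [set b' : W v | `|b f - b' f| < e] => // p pb /=; exists p.
move: pb pF; rewrite /= /ev asboolT// => pb pF.
have : `|F y - b f| < e + e.
  rewrite (le_lt_trans (ler_distD (f p) _ _))// ltrD//.
  by rewrite distrC.
by rewrite -splitr ltxx.
Qed.

Let represents_uniq v (b : W v) y y' :
  represents b y -> represents b y' -> y = y'.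
Proof.
move=> hy hy'; apply: contrapT => yy'.
have c1 (z : Y v) : closed [set z].
  by apply: compact_closed; [exact: cspace_hausdorff|exact: compact_set1].
have d0 : [set y] `&` [set y'] = set0 by rewrite -subset0 => z [/= ->].
have [F [cF F01 Fy Fy']] := compact_urysohn R (c1 _) (c1 _) d0.
have uF : unit_valued F by split.
have := hy F uF; rewrite -(hy' F uF) (Fy y)// (Fy' y')// => /eqP.
by rewrite eq_sym oner_eq0.
Qed.

Definition boundary_point v (b : W v) : Y v := xget point (represents b).

Let boundary_pointP v b : @hull v b -> represents b (boundary_point b).
Proof.
move=> /represents_ex[y hy].
by apply: (@xgetPex _ point (represents b)); exists y.
Qed.

Lemma boundary_pointE v b (F : Y v -> R) : @hull v b -> continuous F ->
  (forall y, 0 <= F y <= 1) -> F (boundary_point b) = b (F \o @orb Y v).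
Proof. by move=> hb cF F01; apply: boundary_pointP. Qed.

Lemma boundary_point_act v w (k : arrow v w) b : @hull v b ->
  act k (boundary_point b) = boundary_point (a k b).
Proof.
move=> hb; have [_ _ iH] := hull_subsystem.
apply: (@represents_uniq _ (a k b)); last first.
  by apply: boundary_pointP; exact: iH.
move=> F [cF F01]; have := @boundary_pointE v b (F \o act k) hb.
rewrite /= => ->//.
  by rewrite /a; congr (b _); apply/funext => p /=; rewrite orb_translate.
by move=> y; apply: continuous_comp; [exact: act_continuous|exact: cF].
Qed.

(** Given an open [V] around the image point, take a Urysohn function [F] that is 0 there and 1 off
    [V]. By [boundary_pointE] the value of [F] at the image is a coordinate of [b], so the condition
    that it is less than 1 is open and forces the image into [V]. *)
Lemma boundary_point_continuous v :
  {within @hull v, continuous (@boundary_point v)}.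
Proof.
apply/subspace_sigL_continuousP => x U; rewrite nbhsE => -[V [oV Vx] VU].
have hb b : hull (set_val (b : set_type (@hull v))) by exact: set_valP.
have c1 (z : Y v) : closed [set z].
  by apply: compact_closed; [exact: cspace_hausdorff|exact: compact_set1].
have cV : closed (~` V) by exact: open_closedC.
have d0 : [set boundary_point (set_val x)] `&` ~` V = set0.
  by rewrite -subset0 => z [/= -> nV]; exact: nV.
have [F [cF F01 Fx FV]] := compact_urysohn R (c1 _) cV d0.
pose f := F \o @orb Y v.
have nx : nbhs x [set b : set_type (@hull v) | set_val b f < 1].
  apply: (@continuous_comp _ _ _ (set_val : set_type (@hull v) -> W v)
    (fun b : W v => b f) x _ _ [set r | r < 1]).
  - exact: set_val_continuous.
  - exact: proj_cont.
  - by apply: lt_nbhsl; rewrite /= -boundary_pointE// Fx.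
apply: filterS nx => b /= bf; apply: VU; apply: contrapT => /FV.
by rewrite /sigL /= boundary_pointE// => E; rewrite E ltxx in bf.
Qed.

End MapToBoundary.

Lemma Furstenberg_boundary_exists :
  exists B : Gspace G, Furstenberg_boundary R B.
Proof.
have [M [sM minM] Mh] := exists_minimal_subsystem hW hull_subsystem.
pose B := subsystem_Gspace hW a_continuous a1 aM sM.
have hB v (x : B v) : hull (set_val x) by apply: Mh; exact: set_valP.
pose phi (Y : Gspace G) v (x : B v) : Y v := boundary_point Y (set_val x).
have gphi (Y : Gspace G) : Gboundary R Y -> Gmap (phi Y).
  move=> bY; split => [v|v w k x]; last exact: boundary_point_act.
  have /subspace_sigL_continuousP :
      {within @M v, continuous (@boundary_point Y v)}.
    exact: continuous_subspaceW (@Mh v) (@boundary_point_continuous Y bY v).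
  exact.
have minB : minimal B by exact: subsystem_Gspace_minimal.
exists B; split; last first.
  move=> Y bY; exists (phi Y); first exact: gphi.
  by apply: minimal_image_surjective; [case: bY|exact: gphi].
split => //; apply: content_proximal_strongly; apply: content_proximal_lift.
move=> v x x' xx'.
(* Distinct points differ at a coordinate, which must be a boundary function coming from some [Y];
   the map to that [Y] then separates them. *)
have [f fxx'] : exists f, set_val x f <> set_val x' f.
  by apply/existsNP => E; apply/xx'/val_inj/funext.
have bf : boundary_function f.
  by apply: contrapT => nf; apply: fxx'; rewrite !hull_non_boundary.
have [Y [bY [F [cF F01] fE]]] := bf.
exists Y, (phi Y); split; last 2 first.
- exact: gphi.
- by move=> E; apply: fxx'; rewrite fE -!(boundary_pointE bY)//; congr F.
- by apply: strongly_proximal_content; case: bY.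
Qed.

End Existence.

Theorem mainTheorem2 (R : realType) (G : groupoid) :
  (exists B : Gspace G, Furstenberg_boundary R B) /\
  (forall B B' : Gspace G,
    Furstenberg_boundary R B -> Furstenberg_boundary R B' -> Gisomorphic B B').
Proof.
split; first exact: Furstenberg_boundary_exists.
exact: Furstenberg_boundary_unique.
Qed.
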